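(* On every instance with $n$ agents and $n$ resources that is single-peaked with respect to an axis $\lhd$, the Diver protocol requires at most $4n$ bits of communication from the agents to the center.
   Context: Setting. $\mathcal{N}$ is a set of $n$ agents and $\mathcal{R}$ a set of $n$ resources. An allocation assigns to each agent a single resource, distinct agents getting distinct resources. Each agent $a_i$ has a strict linear order $\succ_i$ over $\mathcal{R}$; $L=\langle\succ_i\rangle_{a_i\in\mathcal{N}}$. An instance is $I=\langle\mathcal{N},\mathcal{R},L,\pi^0\rangle$ with $\pi^0$ an initial allocation. For $R\subseteq\mathcal{R}$, $top_R(a_i)$ is the $\succ_i$-most preferred resource in $R$. Single-peakedness. Given a linear order (axis) $\lhd$ on $\mathcal{R}$, a linear order $\succ$ on $\mathcal{R}$ with top resource $top(\succ)$ is single-peaked with respect to $\lhd$ if for all $r,r'\in\mathcal{R}$ with $r'\lhd r\lhd top(\succ)$ or $top(\succ)\lhd r\lhd r'$ one has $r\succ r'$. The instance is single-peaked with respect to $\lhd$ if all $\succ_i$ are. The axis $\lhd$ and the initial allocation are commonly known; agent $a_i$ alone knows $\succ_i$. The Diver protocol. Sort the agents from left to right along $\lhd$ according to the resource they hold in $\pi^0$; relabel so that the $i$-th agent is $a_i$, holding $r_i$, with $r_1\lhd\dots\lhd r_n$. Let $R$ be the set of remaining (not yet picked) resources, initially $\mathcal{R}$, and $D$ an initially empty list. ''Picking'' means that the agent leaves with the resource she holds, which is removed from $R$ (and the agent is removed from $D$ if she is in it); every pick is announced by the center to the remaining agents. For $i=1,\dots,n$ in turn, the center asks $a_i$ which of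 three cases holds, and this query is answered with 2 bits: (1) pick: $top_R(a_i)=r_i$. Then $a_i$ picks $r_i$, and the center runs the backtrack-call: it asks the agents $a_j$ of $D$, last appended first, whether they still agree to dive to the next resource $r_{i+1}$ (a yes/no query answered with 1 bit; ''no'' means $r_j\succ_j r_{i+1}$, and ''no'' is the answer if $i=n$). An agent answering ''no'' picks $r_j$ and is removed from $D$, and the backtrack-call continues; it stops at the first ''yes'' or when $D$ is empty. (2) pass: $top_R(a_i)$ is to the right of $r_i$. Then $a_i$ is appended at the end of $D$. (3) pick a smaller resource: $top_R(a_i)$ is to the left of $r_i$. Then the protocol stops and returns ''not PO''. If the loop over $i$ ends without having returned, the protocol returns ''PO''. Only bits sent from the agents to the center are counted. *)

(* Defs.v *)
From mathcomp Require Import all_boot.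

Set Implicit Arguments.
Unset Strict Implicit.
Unset Printing Implicit Defensive.

(* [P r r'] reads "r is preferred to r'" for a preference P,
   and [axis r r'] reads "r is to the left of r'" for an axis. *)

Definition strict_linear (T : finType) (lt : rel T) : Prop :=
  [/\ irreflexive lt, transitive lt & forall x y, x != y -> lt x y || lt y x].

(* [None] exactly when S is empty, for P strict linear. *)
Definition top (res : finType) (P : rel res) (S : {set res}) : option res :=
  [pick t in S | [forall r in S, (r != t) ==> P t r]].

Record instance (agent res : finType) := Instance {
  pref : agent -> rel res;
  init : agent -> res;
  pref_linear : forall a, strict_linear (pref a);
  init_inj : injective init
}.

Definition single_peaked (res : finType) (axis P : rel res) : Prop :=
  forall t, top P [set: res] = Some t ->
  forall r r', (axis r' r /\ axis r t) \/ (axis t r /\ axis r r') -> P r r'.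

Definition single_peaked_instance (agent res : finType) (axis : rel res)
    (I : instance agent res) : Prop :=
  forall a, single_peaked axis (pref I a).

Inductive verdict := PO | NotPO.

(* Deterministic protocols as decision trees. At [Ask a w msg next], agent [a]
   sends the w-bit string [msg P], where P is her private preference, and the
   protocol goes on with [next] of this string. What the center announces is
   free, and the public information at a node (axis, initial allocation,
   earlier messages) is determined by the position of the node in the tree;
   the preferences enter only through [msg]. *)
Inductive protocol (agent res : finType) : Type :=
| Return of verdict
| Ask (a : agent) (w : nat) (msg : rel res -> w.-tuple bool)
      (next : w.-tuple bool -> protocol agent res).
Arguments Return {agent res}.

(* Bits sent by the agents when the protocol is run on the preferences L. *)
Fixpoint bits_sent (agent res : finType) (p : protocol agent res)
    (L : agent -> rel res) : nat :=
  match p with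
  | Return _ => 0
  | Ask a w msg next => w + bits_sent (next (msg (L a))) L
  end.

Inductive answer := Pick | Pass | PickSmaller.

Definition encode (x : answer) : 2.-tuple bool :=
  match x with
  | Pick => [tuple false; false]
  | Pass => [tuple false; true]
  | PickSmaller => [tuple true; false]
  end.

(* The word (true, true) is never sent. *)
Definition decode (b : 2.-tuple bool) : answer :=
  if tnth b ord0 then PickSmaller
  else if tnth b ord_max then Pass else Pick.

(* Answer of an agent with preference P, holding r, when S remains. The [None]
   case does not occur: an agent who is asked still holds r, so r is in S. *)
Definition main_answer (res : finType) (axis P : rel res) (S : {set res})
    (r : res) : answer :=
  match top P S with
  | Some t => if t == r then Pick
              else if axis r t then Pass else PickSmaller
  | None => PickSmaller
  end.

(* Does an agent with preference P, holding r, agree to dive to the next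
   resource? [None] means that there is no next resource. *)
Definition dive_answer (res : finType) (P : rel res) (r : res)
    (nextr : option res) : bool :=
  if nextr is Some r' then ~~ P r r' else false.

Section Diver.
Variables (agent res : finType) (axis : rel res) (hold : agent -> res).

(* The list D of divers is kept in reverse: its head is the last appended. The
   continuation k receives D and the remaining resources S as updated. *)
Fixpoint backtrack (nextr : option res) (D : seq agent) (S : {set res})
    (k : seq agent -> {set res} -> protocol agent res) : protocol agent res :=
  if D is a :: D' then
    Ask a (fun P => [tuple dive_answer P (hold a) nextr])
      (fun b : 1.-tuple bool =>
         if tnth b ord0 then k D S
         else backtrack nextr D' (S :\ hold a) k)
  else k [::] S.

(* The list s contains the agents not visited yet, from left to right. *)
Fixpoint diver_loop (s : seq agent) (D : seq agent) (S : {set res})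
    : protocol agent res :=
  if s is a :: s' then
    Ask a (fun P => encode (main_answer axis P S (hold a)))
      (fun b => match decode b with
         | Pick => backtrack (ohead (map hold s')) D (S :\ hold a)
                     (fun D' S' => diver_loop s' D' S')
         | Pass => diver_loop s' (a :: D) S
         | PickSmaller => Return NotPO
         end)
  else Return PO.

Definition left_to_right : seq agent :=
  sort (fun a b => (a == b) || axis (hold a) (hold b)) (enum agent).

Definition diver : protocol agent res :=
  diver_loop left_to_right [::] [set: res].

End Diver.

(* Main.v *)
(* The potential 4 * (agents not visited) + (agents in D) pays for every bit: a
   pass spends 2 bits and appends one agent to D; a pick spends 2 bits, plus at
   most one for a "yes", plus one for each "no", which removes an agent
   from D. *)
Require Import Defs.
From mathcomp Require Import all_boot.

Section Bits.
Variables (agent res : finType) (axis : rel res) (hold : agent -> res).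
Variable L : agent -> rel res.

(** Each [no] bit is paid for by the diver it removes; the extra unit covers the single [yes] that
    may end the call. *)
Lemma bits_sent_backtrack (B : nat) nextr D S k :
  (forall D' S', bits_sent (k D' S') L <= B + size D') ->
  bits_sent (backtrack hold nextr D S k) L <= (B + size D).+1.
Proof.
move=> kB; elim: D S => [|a D IHD] S /=; first exact/leqW/kB.
rewrite add1n ltnS; case: (tnth _ _); first exact: kB.
by rewrite addnS; exact: IHD.
Qed.

Lemma bits_sent_diver_loop s D S :
  bits_sent (diver_loop axis hold s D S) L <= 4 * size s + size D.
Proof.
elim: s D S => [|a s IHs] D S //=.
(* Of the 4 units released by visiting [a], 2 pay for the main query; a pick or a pass then needs
   only one more, and [leqW] drops the other. *)
rewrite mulnS -(addnA 4) -(addnA 2 2) leq_add2l.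
case: (decode _) => //=.
- by apply/leqW/bits_sent_backtrack => D' S'; exact: IHs.
- by apply/leqW; rewrite -addnS; exact: IHs.
Qed.

End Bits.

Theorem proposition3 (n : nat) (agent res : finType)
    (card_agent : #|agent| = n) (card_res : #|res| = n)
    (I : instance agent res) (axis : rel res)
    (axis_linear : strict_linear axis)
    (sp : single_peaked_instance axis I) :
  bits_sent (diver axis (init I)) (pref I) <= 4 * n.
Proof.
apply: (leq_trans (bits_sent_diver_loop _ _ _ _ _ _ _ _)).
(* No agent is in [D] at the start, so the initial potential is [4 * n]. *)
by rewrite addn0 size_sort -cardE card_agent.
Qed.
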